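(* Let $0<k<n$ be integers. The complex Grassmannian $\mathbb G(k,n)$ is coalescing if and only if $P_1(n)\leq k\leq n-P_1(n)$, where $P_1(n)$ is the smallest prime divisor of $n$. In particular, if $p$ is prime, then $\mathbb G(k,p)$ is not coalescing for every $0<k<p$.
   Context: For integers $0<k<n$, $\mathbb G(k,n)$ denotes the Grassmannian of $k$-dimensional complex subspaces of $\mathbb C^n$. Its small quantum cohomology at the point $p=t\sigma_1\in H^2(\mathbb G(k,n);\mathbb C)$ ($\sigma_1$ the special Schubert class generating $H^2$, $t\in\mathbb C$, $q=e^t$) is the commutative associative algebra structure on $H^\bullet(\mathbb G(k,n);\mathbb C)$ given by $\sigma_\lambda *_q\sigma_\mu=\sum_{d\ge 0}\sum_\nu q^d\langle\sigma_\lambda,\sigma_\mu,\sigma_\nu^\vee\rangle_{0,3,d}\,\sigma_\nu$, where $(\sigma_\lambda)_\lambda$ are the Schubert classes, $\sigma_\nu^\vee$ is the Poincaré dual basis, and $\langle\cdot,\cdot,\cdot\rangle_{0,3,d}$ are the genus $0$ three-point Gromov-Witten invariants of degree $d$. By a well-known presentation, this algebra is isomorphic to $\mathbb C[x_1,\dots,x_k]^{\mathfrak S_k}/\langle h_{n-k+1},\dots,h_{n-1},\,h_n-(-1)^{k-1}q\rangle$, where $h_j$ is the $j$-th complete symmetric polynomial in $x_1,\dots,x_k$ (the Chern roots of the dual of the tautological bundle), and $c_1(\mathbb G(k,n))=n\sigma_1=n(x_1+\dots+x_k)$. The Dubrovin canonical coordinates at $p$ are the eigenvalues, counted with multiplicity,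 of the operator $c_1(\mathbb G(k,n))*_q(-)$ on $H^\bullet(\mathbb G(k,n);\mathbb C)$. The Grassmannian $\mathbb G(k,n)$ is called coalescing if for some (equivalently, every) point $p\in H^2(\mathbb G(k,n);\mathbb C)$ these eigenvalues are not pairwise distinct (i.e. the spectrum of the operator is not simple). *)

(* Defs.v *)
From HB Require Import structures.
From mathcomp Require Import all_boot all_algebra.
From mathcomp Require Import generic_quotient ring_quotient.
From mathcomp Require Import complex mpoly.
From mathcomp Require boolp.
From mathcomp Require Import reals sequences exp trigo.

Set Implicit Arguments.
Unset Strict Implicit.
Unset Printing Implicit Defensive.

Import GRing.Theory.
Local Open Scope ring_scope.
Local Open Scope quotient_scope.

Section Spectrum.
Variables (K : fieldType) (V : lmodType K).

Definition is_basis (N : nat) (b : 'I_N -> V) : Prop :=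
  forall v : V, exists! a : 'rV[K]_N, v = \sum_(i < N) a 0 i *: b i.

(* Row convention: row i of M holds the coordinates of T (b i). *)
Definition is_matrix_of (N : nat) (b : 'I_N -> V) (T : {linear V -> V})
    (M : 'M[K]_N) : Prop := forall i : 'I_N, T (b i) = \sum_(j < N) M i j *: b j.

(* The sequence s lists the eigenvalues of the endomorphism T of the
   finite-dimensional space V with their algebraic multiplicities; the
   characteristic polynomial does not depend on the chosen basis. *)
Definition eigenvalues_of (T : {linear V -> V}) (s : seq K) : Prop :=
  exists (N : nat) (b : 'I_N -> V) (M : 'M[K]_N),
    [/\ is_basis b, is_matrix_of b T M
      & char_poly M = \prod_(a <- s) ('X - a%:P)].

End Spectrum.

(* The algebra K[x_1, ..., x_k]^{S_k}. *)
Section SymPoly.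
Variables (k : nat) (K : fieldType).

Record sympoly := SymPoly {
  sympoly_val :> {mpoly K[k]};
  sympolyP : sympoly_val \is @symmetric k K
}.

HB.instance Definition _ := [isSub for sympoly_val].
HB.instance Definition _ := [Choice of sympoly by <:].
HB.instance Definition _ :=
  [SubChoice_isSubComNzRing of sympoly by <:].
HB.instance Definition _ := [SubZmodule_isSubLmodule of sympoly by <:].
HB.instance Definition _ :=
  [SubNzRing_SubLmodule_isSubLalgebra of sympoly by <:].
HB.instance Definition _ := [SubLalgebra_isSubAlgebra of sympoly by <:].

Definition complete_mpoly (j : nat) : {mpoly K[k]} :=
  \sum_(m : 'X_{1..k < j.+1} | mdeg m == j) 'X_[m].

Lemma mcoeff_complete j m : (complete_mpoly j)@_m = (mdeg m == j)%:R.
Proof.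
rewrite /complete_mpoly raddf_sum /=.
under eq_bigr => i _ do rewrite mcoeffX.
have [mj|mj] := eqVneq (mdeg m) j; last first.
  rewrite big1 // => i /eqP ij; case: eqP => // im.
  by move: mj; rewrite -im ij eqxx.
have lt_m : (mdeg m < j.+1)%N by rewrite mj.
rewrite (bigD1 (BMultinom lt_m)) /= ?mj // eqxx big1 ?addr0 // => i.
case/andP=> _ ne; case: eqP => // im; case/eqP: ne.
exact/val_inj.
Qed.

Lemma complete_mpoly_sym j : complete_mpoly j \is @symmetric k K.
Proof.
apply/issymP => s; apply/mpolyP => m.
by rewrite mcoeff_sym !mcoeff_complete mdeg_mperm.
Qed.

Definition complete (j : nat) : sympoly := SymPoly (complete_mpoly_sym j).

Lemma sum_vars_sym : \sum_(i < k) 'X_i \is @symmetric k K.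
Proof. by rewrite -mesym1E mesym_sym. Qed.

Definition sum_vars : sympoly := SymPoly sum_vars_sym.

End SymPoly.

(* The quotient A / <gs>. MathComp's {ideal_quot _} requires the ideal to be
   proper; the quotient is built here for an arbitrary finite family gs, so it
   is only a comPzRingType and an lmodType. *)
Section AlgQuotient.
Variables (K : fieldType) (A : comAlgType K) (gs : seq A).

Definition ideal_gen : {pred A} := fun f =>
  boolp.asbool
    (exists a : 'I_(size gs) -> A, f = \sum_(i < size gs) a i * gs`_i).

Lemma ideal_genP (f : A) :
  reflect (exists a : 'I_(size gs) -> A, f = \sum_(i < size gs) a i * gs`_i)
          (f \in ideal_gen).
Proof. exact: boolp.asboolP. Qed.

Lemma ideal_gen_zmod_closed : zmod_closed ideal_gen.
Proof.
split=> [|f g /ideal_genP[a ->] /ideal_genP[b ->]]; apply/ideal_genP.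
  by exists (fun=> 0); rewrite big1 // => i _; rewrite mul0r.
exists (fun i => a i - b i); rewrite -sumrB.
by apply: eq_bigr => i _; rewrite mulrBl.
Qed.

HB.instance Definition _ :=
  GRing.isZmodClosed.Build A ideal_gen ideal_gen_zmod_closed.

Lemma ideal_genM (f g : A) : g \in ideal_gen -> f * g \in ideal_gen.
Proof.
move=> /ideal_genP[a ->]; apply/ideal_genP; exists (fun i => f * a i).
by rewrite mulr_sumr; apply: eq_bigr => i _; rewrite mulrA.
Qed.

Lemma ideal_genZ (c : K) (g : A) : g \in ideal_gen -> c *: g \in ideal_gen.
Proof. by move=> gI; rewrite -[g]mul1r scalerAl ideal_genM. Qed.

Definition alg_quot : Type := Quotient.quot ideal_gen.

HB.instance Definition _ := GRing.Zmodule.on alg_quot.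
HB.instance Definition _ := EqQuotient.on alg_quot.

Lemma alg_quotE (x y : A) :
  (\pi_alg_quot x == \pi_alg_quot y) = (x - y \in ideal_gen).
Proof. exact/esym/Quotient.idealrBE. Qed.

Lemma alg_quot_eq (x y : A) :
  x - y \in ideal_gen -> \pi_alg_quot x = \pi_alg_quot y.
Proof. by rewrite -alg_quotE => /eqP. Qed.

Lemma alg_quot_repr (x : A) : x - repr (\pi_alg_quot x) \in ideal_gen.
Proof. by rewrite -alg_quotE reprK. Qed.

Lemma alg_quotD (x y : A) :
  \pi_alg_quot (x + y) = \pi_alg_quot x + \pi_alg_quot y.
Proof. exact: (Quotient.pi_add ideal_gen x y). Qed.

Definition aq_one : alg_quot := \pi_alg_quot 1.
Definition aq_mul (u v : alg_quot) : alg_quot := \pi_alg_quot (repr u * repr v).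
Definition aq_scale (c : K) (u : alg_quot) : alg_quot := \pi_alg_quot (c *: repr u).

Lemma aq_mulE (x y : A) :
  aq_mul (\pi_alg_quot x) (\pi_alg_quot y) = \pi_alg_quot (x * y).
Proof.
apply/esym/alg_quot_eq.
set x' := repr _; set y' := repr _.
rewrite (_ : _ - _ = y * (x - x') + x' * (y - y')); last first.
  by rewrite !mulrBr addrA (mulrC y x) (mulrC y x') subrK.
by apply: rpredD; apply/ideal_genM/alg_quot_repr.
Qed.

Lemma aq_scaleE c (x : A) : aq_scale c (\pi_alg_quot x) = \pi_alg_quot (c *: x).
Proof.
by apply/esym/alg_quot_eq; rewrite -scalerBr; apply/ideal_genZ/alg_quot_repr.
Qed.

Lemma aq_mulA : associative aq_mul.
Proof.
move=> u v w; rewrite -[u]reprK -[v]reprK -[w]reprK.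
by rewrite (aq_mulE (repr v)) (aq_mulE (repr u) (repr v)) !aq_mulE mulrA.
Qed.

Lemma aq_mulC : commutative aq_mul.
Proof. by move=> u v; rewrite /aq_mul mulrC. Qed.

Lemma aq_mul1 : left_id aq_one aq_mul.
Proof. by move=> u; rewrite -[u]reprK aq_mulE mul1r. Qed.

Lemma aq_mulDl : left_distributive aq_mul +%R.
Proof.
move=> u v w; rewrite -[u]reprK -[v]reprK -[w]reprK -alg_quotD !aq_mulE.
by rewrite mulrDl alg_quotD.
Qed.

HB.instance Definition _ :=
  GRing.Zmodule_isComPzRing.Build alg_quot aq_mulA aq_mulC aq_mul1 aq_mulDl.

Lemma aq_scaleA a b v : aq_scale a (aq_scale b v) = aq_scale (a * b) v.
Proof. by rewrite -[v]reprK (aq_scaleE b) !aq_scaleE scalerA. Qed.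

Lemma aq_scale1 : left_id 1 aq_scale.
Proof. by move=> v; rewrite -[v]reprK aq_scaleE scale1r. Qed.

Lemma aq_scaleDr : right_distributive aq_scale +%R.
Proof.
move=> a u v; rewrite -[u]reprK -[v]reprK -alg_quotD !aq_scaleE.
by rewrite scalerDr alg_quotD.
Qed.

Lemma aq_scaleDl v : {morph aq_scale^~ v : a b / a + b}.
Proof.
by move=> a b; rewrite -[v]reprK !aq_scaleE scalerDl alg_quotD.
Qed.

HB.instance Definition _ := GRing.Zmodule_isLmodule.Build K alg_quot
  aq_scaleA aq_scale1 aq_scaleDr aq_scaleDl.

Lemma aq_scalerAl (c : K) (u v : alg_quot) : c *: (u * v) = (c *: u) * v.
Proof.
rewrite -[u]reprK -[v]reprK; set x := repr u; set y := repr v.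
change (aq_scale c (aq_mul (\pi_alg_quot x) (\pi_alg_quot y)) =
        aq_mul (aq_scale c (\pi_alg_quot x)) (\pi_alg_quot y)).
by rewrite (aq_mulE x) !aq_scaleE aq_mulE scalerAl.
Qed.

End AlgQuotient.

Local Open Scope complex_scope.

Definition cexp (R : realType) (t : R[i]) : R[i] :=
  let: a +i* b := t in (expR a * cos b) +i* (expR a * sin b).

Section QuantumCohomology.
Variables (R : realType) (k n : nat).

(* h_(n-k+1), ..., h_(n-1), h_n - (-1)^(k-1) q *)
Definition qh_relations (q : R[i]) : seq (sympoly k R[i]) :=
  rcons [seq complete k R[i] j | j <- index_iota (n - k).+1 n]
        (complete k R[i] n - ((-1) ^+ k.-1 * q)%:A).

(* The small quantum cohomology algebra of G(k, n) with quantum parameter q,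
   through its presentation by the Chern roots x_1, ..., x_k of the dual of
   the tautological bundle. *)
Definition QH (q : R[i]) := alg_quot (qh_relations q).

(* c_1(G(k, n)) = n sigma_1 = n (x_1 + ... + x_k) *)
Definition c1 (q : R[i]) : QH q := \pi_(QH q) (sum_vars k R[i] *+ n).

Definition c1_mul (q : R[i]) (x : QH q) : QH q := c1 q * x.

Lemma c1_mul_linear (q : R[i]) : linear (@c1_mul q).
Proof.
by move=> a x y; rewrite /c1_mul mulrDr mulrC -aq_scalerAl [x * _]mulrC.
Qed.

HB.instance Definition _ (q : R[i]) :=
  GRing.isLinear.Build R[i] (QH q) (QH q) *:%R (@c1_mul q)
    (@c1_mul_linear q).

(* The spectrum of c_1 *_q at the point t sigma_1 of H^2, i.e. at q = e^t, is
   not simple. *)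
Definition coalescing_at (t : R[i]) : Prop :=
  exists s : seq R[i], eigenvalues_of (@c1_mul (cexp t)) s /\ ~~ uniq s.

Definition coalescing : Prop := exists t : R[i], coalescing_at t.

End QuantumCohomology.

Arguments coalescing_at : clear implicits.
Arguments coalescing : clear implicits.

(* Main.v *)
(* In the quotient algebra the relations force x_i^n = c := (-1)^(k-1) q for every
   Chern root, and h_(n-1)(x_i, x_j) = 0 for i <> j.  The first identity allows
   Lagrange interpolation at the n roots of z^n = c, the second kills the
   interpolation idempotents of tuples with a repetition; after averaging over
   S_k, a symmetric polynomial is zero in the quotient as soon as it vanishes at
   the k-subsets of the roots of z^n = c.  Hence the algebra is K^(subsets), and
   up to a common nonzero factor the eigenvalues of c_1 are the sums of k distinct
   n-th roots of unity.

   It remains to decide when two distinct k-subsets of the n-th roots of unity have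
   the same sum.  Exchanging two cosets of the roots of order P_1(n) gives such
   subsets when P_1(n) <= k <= n - P_1(n).  Conversely, two disjoint multisets, not
   both empty, of n-th roots of unity with the same sum cannot both have less than
   P_1(n) elements: by induction on n, writing n = m P with P := P_1(n), one splits
   them along the cosets of the m-th roots of unity and compares the partial sums
   by means of the automorphisms of Q(w) over Q(w^P) or Q(w^m). *)
From HB Require Import structures.
Require Import Defs.
From mathcomp Require Import all_boot all_order all_algebra all_fingroup all_field.
From mathcomp Require cyclic.
From mathcomp Require Import generic_quotient mpoly complex.
From mathcomp Require Import reals exp trigo zify.

Set Implicit Arguments.
Unset Strict Implicit.
Unset Printing Implicit Defensive.

Import Order.TTheory GRing.Theory Num.Theory.

Local Open Scope ring_scope.

(** * Sums of roots of unity *)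

(** [w] is a root of X^n - 1, the product of the Phi_d for d | n, hence of some Phi_d; then w^d = 1,
    so n | d and d = n. *)
Lemma root_Cyclotomic (F : fieldType) n (w : F) :
  n.-primitive_root w -> root (map_poly intr 'Phi_n) w.
Proof.
move=> w_prim; have n_gt0 := prim_order_gt0 w_prim.
have phiE m : (0 < m)%N ->
    \prod_(d <- divisors m) map_poly intr 'Phi_d = 'X^m - 1 :> {poly F}.
  move=> m_gt0; rewrite -rmorph_prod prod_Cyclotomic //.
  by rewrite rmorphB rmorph1 /= map_polyXn.
have: root (\prod_(d <- divisors n) map_poly intr 'Phi_d) w.
  by rewrite phiE //; exact/unity_rootP/(prim_expr_order w_prim).
rewrite /root horner_prod prodf_seq_eq0 => /hasP[d].
rewrite -dvdn_divisors //= => d_dvd root_d.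
have d_gt0 := dvdn_gt0 n_gt0 d_dvd.
suff ->: n = d by [].
apply/eqP; rewrite eqn_dvd d_dvd andbT (prim_order_dvd w_prim).
apply/eqP/unity_rootP; rewrite /root_of_unity -phiE //.
rewrite /root horner_prod prodf_seq_eq0; apply/hasP; exists d => //.
by rewrite -dvdn_divisors.
Qed.

(** Irreducibility of Phi_n over the rationals, carried to [F] through algebraic numbers: gcd(Phi_n,
    h) has the root [w], so it is nonconstant and has a root [x] in [algC]; Phi_n is the minimal
    polynomial of [x], so it divides the gcd. *)
Lemma Cyclotomic_dvdp (F : numFieldType) n (w : F) (h : {poly rat}) :
  n.-primitive_root w -> root (map_poly ratr h) w ->
  map_poly intr 'Phi_n %| h.
Proof.
move=> w_prim hw; set phi := map_poly intr _.
have n_gt0 := prim_order_gt0 w_prim.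
have ratr_phi (F' : numFieldType) :
    map_poly (ratr : rat -> F') phi = map_poly intr 'Phi_n.
  by rewrite -map_poly_comp; apply: eq_map_poly => z /=; rewrite ratr_int.
have phi_neq0 : phi != 0.
  apply: monic_neq0; exact/monic_map/Cyclotomic_monic.
set d := gcdp phi h.
have dw : root (map_poly ratr d) w.
  by rewrite gcdp_map root_gcd hw ratr_phi root_Cyclotomic.
have d_neq0 : d != 0 by rewrite gcdp_eq0 negb_and phi_neq0.
have size_d : (1 < size d)%N.
  rewrite -(size_map_poly (ratr : {rmorphism rat -> F})).
  by apply: root_size_gt1 dw; rewrite map_poly_eq0.
have [x dx] : exists x : algC, root (map_poly ratr d) x.
  apply/closed_rootP; rewrite size_map_poly neq_ltn size_d orbT //.
have x_prim : n.-primitive_root x.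
  have [z z_prim] := C_prim_root_exists n_gt0.
  rewrite -(root_cyclotomic z_prim) -(Cintr_Cyclotomic z_prim) -ratr_phi.
  apply: root_dvdp dx; rewrite dvdp_map; exact: dvdp_gcdl.
suff: phi %| d by move/dvdp_trans; apply; exact: dvdp_gcdr.
have [p [Dp _] dv_p] := minCpolyP x.
suff ->: phi = p by rewrite -dv_p.
apply: (map_inj_poly (fmorph_inj (ratr : {rmorphism rat -> algC}))).
  by rewrite rmorph0.
by rewrite -Dp ratr_phi (minCpoly_cyclotomic x_prim) (Cintr_Cyclotomic x_prim).
Qed.

(* The Galois automorphism w |-> w^k of Q(w), for sums of roots of unity. *)
Lemma unity_root_sum_conj (F : numFieldType) n (w : F) (k : nat) (s t : seq F) :
  n.-primitive_root w -> coprime k n ->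
  all n.-unity_root s -> all n.-unity_root t ->
  \sum_(u <- s) u = \sum_(u <- t) u ->
  \sum_(u <- s) u ^+ k = \sum_(u <- t) u ^+ k.
Proof.
move=> w_prim co_kn s1 t1 st.
have n_gt0 := prim_order_gt0 w_prim.
(* For an n-th root of unity [u], [e u] is an exponent with u = w^(e u); the rational polynomial
   [P r] then takes at w^j the value of the j-th power sum of [r]. *)
pose e (u : F) : nat := find (fun i => u == w ^+ i) (iota 0 n).
have eP u : n.-unity_root u -> w ^+ (e u) = u.
  move/unity_rootP => /(prim_rootP w_prim) [i ->].
  have h : has (fun j => w ^+ i == w ^+ j) (iota 0 n).
    by apply/hasP; exists (val i); rewrite ?mem_iota ?eqxx ?add0n /=.
  have := nth_find 0 h; move: h; rewrite has_find size_iota => h.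
  by rewrite nth_iota // add0n => /eqP.
pose P (r : seq F) : {poly rat} := \sum_(u <- r) 'X^(e u).
have PE r j : all n.-unity_root r ->
    (map_poly ratr (P r)).[w ^+ j] = \sum_(u <- r) u ^+ j.
  move=> /allP r1; rewrite rmorph_sum horner_sum !big_seq.
  apply: eq_bigr => u /r1 u1.
  by rewrite /= map_polyXn hornerXn -exprM mulnC exprM eP.
have h1 : root (map_poly ratr (P s - P t)) w.
  rewrite /root rmorphB hornerD hornerN -[w]expr1 !PE // subr_eq0.
  exact/eqP.
have : root (map_poly ratr (P s - P t)) (w ^+ k).
  have wk : n.-primitive_root (w ^+ k) by rewrite prim_root_exp_coprime.
  have := Cyclotomic_dvdp w_prim h1.
  rewrite -(dvdp_map (ratr : {rmorphism rat -> F})) => /root_dvdp; apply.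
  rewrite -map_poly_comp (eq_map_poly (ratr_int F)); exact: root_Cyclotomic.
by rewrite /root rmorphB hornerD hornerN !PE // subr_eq0 => /eqP.
Qed.

Lemma sum_expr_unity_root (F : fieldType) n (y : F) :
  y ^+ n = 1 -> y != 1 -> \sum_(i < n) y ^+ i = 0.
Proof.
move=> yn1 y1; apply/eqP; have: (y - 1) * (\sum_(i < n) y ^+ i) == 0.
  by rewrite -subrX1 yn1 subrr.
by rewrite mulf_eq0 subr_eq0 (negPf y1).
Qed.

(** Fourier inversion on the group of order P: as u^m and x^j are P-th roots of unity, the geometric
    sum of the (u^m / x^j)^i is P if they agree and 0 otherwise. *)
Lemma sum_prim_root_filter (F : fieldType) P (x : F) m (r : seq F) (G : F -> F) j :
  P.-primitive_root x -> all (m * P).-unity_root r ->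
  \sum_(i < P) (x ^+ j) ^- i * (\sum_(u <- r) G u * u ^+ (m * i)) =
  P%:R * \sum_(u <- r | u ^+ m == x ^+ j) G u.
Proof.
move=> x_prim /allP r1.
have x_neq0 : x != 0 by rewrite (prim_root_eq0 x_prim) -lt0n (prim_order_gt0 x_prim).
under eq_bigr do rewrite mulr_sumr.
rewrite exchange_big /= mulr_sumr [RHS]big_mkcond /= !big_seq.
apply: eq_bigr => u /r1 /unity_rootP u1.
transitivity (G u * \sum_(i < P) (u ^+ m / x ^+ j) ^+ i).
  rewrite mulr_sumr; apply: eq_bigr => i _.
  by rewrite exprMn exprVn exprM mulrCA [_ ^- i * _]mulrC.
have [->|ne] := eqVneq.
  rewrite divff ?expf_neq0 //; under eq_bigr do rewrite expr1n.
  by rewrite sumr_const card_ord mulrC.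
rewrite sum_expr_unity_root ?mulr0 //.
  rewrite exprMn exprVn -exprM u1 -exprM mulnC exprM (prim_expr_order x_prim).
  by rewrite expr1n divr1.
by apply: contra ne => /eqP e; rewrite -[u ^+ m](divfK (expf_neq0 j x_neq0)) e mul1r.
Qed.

Lemma sum_size_filter_prim_root (F : fieldType) P (x : F) m (r : seq F) :
  P.-primitive_root x -> all (m * P).-unity_root r ->
  (\sum_(j < P) size [seq u <- r | u ^+ m == x ^+ j])%N = size r.
Proof.
move=> x_prim; elim: r => [|u r IH] /=; first by rewrite big1.
case/andP=> /unity_rootP u1 /IH {IH}<-.
have [j Dj] : {j : 'I_P | u ^+ m = x ^+ j}.
  by apply: (prim_rootP x_prim); rewrite -exprM.
rewrite (bigD1 j) //= Dj eqxx [in RHS](bigD1 j) //= addSn; congr (_ + _).+1.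
apply: eq_bigr => i ij.
by rewrite (eq_prim_root_expr x_prim) !modn_small // eq_sym (inj_eq val_inj) (negPf ij).
Qed.

Lemma pdiv_cofactor_le n q : (1 < n)%N -> ~~ (pdiv n %| n %/ pdiv n)%N ->
  prime q -> (q %| n %/ pdiv n)%N -> (pdiv n < q)%N.
Proof.
move=> n1 ndv q_pr q_dv; rewrite ltn_neqAle; apply/andP; split.
  by apply: contra ndv => /eqP {1}->.
apply: pdiv_min_dvd; first exact: prime_gt1.
by apply: dvdn_trans q_dv _; apply/dvdnP; exists (pdiv n);
  rewrite mulnC divnK ?pdiv_dvd.
Qed.

(** Indices i and j contribute at least p + 1 together and each of the P - 2 others at least 1, so
    the two sums total at least 2p - 1 and the larger is at least p. *)
Lemma box_count P p (a b : 'I_P -> nat) (i j : 'I_P) :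
  (p <= P)%N -> (forall k, 0 < a k + b k)%N -> b i = 0%N -> a j = 0%N ->
  (p < a i + b j)%N -> (p <= maxn (\sum_k a k) (\sum_k b k))%N.
Proof.
move=> pP ab bi aj lt_p.
have ij : j != i by apply/eqP => ji; have := ab i; rewrite bi -ji aj.
suff : (p + p <= ((\sum_k a k) + (\sum_k b k)).+1)%N by lia.
have : (\sum_(k < P) 1 = 2 + \sum_(k < P | (k != i) && (k != j)) 1)%N.
  by rewrite (bigD1 i) //= (bigD1 j).
rewrite [in LHS]sum1_card card_ord => DP;
  rewrite -big_split /= (bigD1 i) //= (bigD1 j) //= bi aj.
have: (\sum_(k < P | (k != i) && (k != j)) 1 <=
       \sum_(k < P | (k != i) && (k != j)) (a k + b k))%N by exact: leq_sum.
move: DP; set A := (\sum_(k < P | _) 1)%N; set B := (\sum_(k < P | _) _)%N; lia.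
Qed.

(** The bound [p] is any lower bound for the prime divisors of [n], not [pdiv n], so that the
    induction may be applied to [m] with [p.+1] as well as with [p]. *)
Lemma unity_root_sum_size (F : numFieldType) n p (w : F) (s t : seq F) :
  n.-primitive_root w -> (forall q, prime q -> (q %| n)%N -> (p <= q)%N) ->
  all n.-unity_root s -> all n.-unity_root t ->
  {in s, forall u, u \notin t} -> (0 < size s + size t)%N ->
  \sum_(u <- s) u = \sum_(u <- t) u -> (p <= maxn (size s) (size t))%N.
Proof.
elim/ltn_ind: n p w s t => n IH p w s t w_prim p_min s1 t1 st_disj st_gt0 st_sum.
have n_gt0 := prim_order_gt0 w_prim.
(* For n = 1 both lists repeat 1, so equal sums mean equal sizes, and disjointness then empties
   both. *)
have [n1|n1] := leqP n 1.
  have {n1} n1 : n = 1%N by lia.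
  subst n.
  have E (r : seq F) : all 1.-unity_root r -> r = nseq (size r) 1.
    move=> /allP r1; apply/all_pred1P/allP => u /r1 /unity_rootP.
    by rewrite expr1 => ->; rewrite /= eqxx.
  move: st_sum st_disj; rewrite (E s) // (E t) // !big_nseq !iter_addr_0 !size_nseq.
  move/eqP; rewrite eqr_nat => /eqP e /(_ 1).
  by rewrite !mem_nseq eqxx !andbT -e; move: st_gt0; rewrite -e;
    case: (size s) => // k _ /(_ isT).
set P := pdiv n; set m := (n %/ P)%N.
have P_pr : prime P by exact: pdiv_prime.
have P_gt0 := prime_gt0 P_pr.
have Dn : n = (m * P)%N by rewrite divnK ?pdiv_dvd.
have m_gt0 : (0 < m)%N by move: n_gt0; rewrite Dn; lia.
have m_lt : (m < n)%N by apply: ltn_Pdiv => //; exact: prime_gt1.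
have p_le : (p <= P)%N by apply: p_min => //; exact: pdiv_dvd.
pose x := w ^+ m.
have x_prim : P.-primitive_root x.
  by have := dvdn_prim_root w_prim (pdiv_dvd n).
have m_prim : m.-primitive_root (w ^+ P).
  have := @dvdn_prim_root _ n w w_prim m; rewrite Dn dvdn_mulr // => /(_ isT).
  by rewrite mulKn.
have fib (r : seq F) u : all n.-unity_root r -> u \in r ->
  exists j : 'I_P, u ^+ m = x ^+ j.
  move=> /allP h /h /unity_rootP u1.
  have [j ->] : {j : 'I_P | u ^+ m = x ^+ j}; last by exists j.
  by apply: (prim_rootP x_prim); rewrite -exprM -Dn.
pose f j (r : seq F) := [seq u <- r | u ^+ m == x ^+ j].
have size_f j r : (size (f j r) <= size r)%N by rewrite size_filter count_size.
have [v v_st] : exists v, v \in s ++ t.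
  have : (0 < size (s ++ t))%N by rewrite size_cat.
  by case: (s ++ t) => // a l _; exists a; rewrite inE eqxx.
have v1 : n.-unity_root v.
  by move: v_st; rewrite mem_cat => /orP[]; [apply: (allP s1) | apply: (allP t1)].
have v_neq0 : v != 0.
  apply: contraTneq v1 => ->; rewrite unity_rootE expr0n eq_sym.
  by rewrite gtn_eqF // oner_eq0.
have [jv Djv] : exists j : 'I_P, v ^+ m = x ^+ j.
  by apply: (@fib [:: v]); rewrite /= ?v1 // inE.
have f_gt0 : (0 < size (f jv s) + size (f jv t))%N.
  rewrite -size_cat -filter_cat size_filter -has_count.
  by apply/hasP; exists v => //; rewrite Djv.
have [Pm|Pm] := boolP (P %| m)%N.
  (* Every 1 + m i is prime to n, so each fibre of u |-> u^m has equal sums. *)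
  have fib_sum j : \sum_(u <- f j s) u = \sum_(u <- f j t) u.
    have P_neq0 : P%:R != 0 :> F by rewrite pnatr_eq0 -lt0n.
    apply: (mulfI P_neq0); rewrite !big_filter.
    rewrite -!(sum_prim_root_filter id _ x_prim) -?Dn //.
    apply: eq_bigr => i _; congr (_ * _).
    under eq_bigr do rewrite -exprS.
    under [RHS]eq_bigr do rewrite -exprS.
    apply: (unity_root_sum_conj w_prim) => //.
    have co_m : coprime (m * i).+1 m.
      by rewrite coprime_sym /coprime -addn1 mulnC gcdnMDl gcdn1.
    by rewrite Dn coprimeMr co_m (coprime_dvdr Pm).
  (* Dividing the fibre of [v] by [v] lands in the m-th roots of unity, where the induction
     applies. *)
  pose g := fun u : F => u / v.
  have g_inj : injective g by apply: mulIf; rewrite invr_eq0.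
  have := IH m m_lt p (w ^+ P) (map g (f jv s)) (map g (f jv t)) m_prim.
  rewrite !size_map => h; apply: leq_trans (h _ _ _ _ _ _) _ => {h} //.
  - move=> q q_pr q_dv; apply: p_min => //.
    by apply: dvdn_trans q_dv _; rewrite Dn dvdn_mulr.
  - apply/allP => _ /mapP[u + ->]; rewrite mem_filter => /andP[/eqP u_v _].
    by apply/unity_rootP; rewrite exprMn exprVn u_v Djv divff // -Djv expf_neq0.
  - apply/allP => _ /mapP[u + ->]; rewrite mem_filter => /andP[/eqP u_v _].
    by apply/unity_rootP; rewrite exprMn exprVn u_v Djv divff // -Djv expf_neq0.
  - move=> _ /mapP[u + ->]; rewrite (mem_map g_inj) !mem_filter => /andP[_ us].
    by rewrite negb_and (st_disj u us) orbT.
  - by rewrite !big_map -!mulr_suml fib_sum.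
  - by rewrite geq_max !leq_max !size_f orbT.
have co_mP : coprime m P by rewrite coprime_sym prime_coprime.
(* On each fibre u |-> u^e is injective with values in the m-th roots of unity;
   as e + m i is prime to n for 0 < i < P, the differences d j do not depend on j. *)
pose e := chinese m P 1 0.
have e_m : e = 1 %[mod m] by exact: chinese_modl.
have e_P : (P %| e)%N by rewrite /dvdn (chinese_modr co_mP) mod0n.
have g_inj j : {in [pred u | n.-unity_root u & u ^+ m == x ^+ j] &, injective (fun u
  => u ^+ e)}.
  move=> u u'; rewrite !inE => /andP[/unity_rootP u1 /eqP um] /andP[/unity_rootP u'1
    /eqP u'm] /= uu'.
  have u'_neq0 : u' != 0.
    by apply: contra_eq_neq u'1 => ->; rewrite expr0n gtn_eqF // eq_sym oner_neq0.
  have q_m : (u / u') ^+ m = 1.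
    by rewrite exprMn exprVn um u'm divff // -u'm expf_neq0.
  have : (u / u') ^+ e = 1 by rewrite exprMn exprVn uu' divff // expf_neq0.
  rewrite -(expr_mod _ q_m) e_m (expr_mod _ q_m) expr1 => /divr1_eq //.
pose g j r := [seq u ^+ e | u <- f j r].
have g1 j r : all n.-unity_root r -> all m.-unity_root (g j r).
  move=> /allP r1; apply/allP => _ /mapP[u + ->];
    rewrite mem_filter => /andP[_ /r1 /unity_rootP u1].
  apply/unity_rootP; rewrite -exprM; have /dvdnP[c ->] := e_P.
  by rewrite -mulnA [(P * m)%N]mulnC -Dn mulnC exprM u1 expr1n.
pose d j := \sum_(u <- g j s) u - \sum_(u <- g j t) u.
have d_const j : d j = d 0%N.
  suff d_val j' : P%:R * d j' = \sum_(u <- s) u ^+ e - \sum_(u <- t) u ^+ e.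
    have P_neq0 : P%:R != 0 :> F by rewrite pnatr_eq0 -lt0n.
    by apply: (mulfI P_neq0); rewrite !d_val.
  (* Fourier filtering writes P (d j) as a sum over i < P; the term i = 0 is the claimed value, and
     for i > 0 the contributions of [s] and [t] cancel by conjugation. *)
  rewrite /d !big_map !big_filter mulrBr -!(sum_prim_root_filter _ _ x_prim) -?Dn //.
  rewrite -(prednK P_gt0) !big_ord_recl /= !expr0 !invr1 !mul1r muln0.
  under eq_bigr do rewrite expr0 mulr1.
  under [X in _ - (X + _)]eq_bigr do rewrite expr0 mulr1.
  rewrite opprD addrACA -[RHS]addr0; congr (_ + _); apply/eqP; rewrite subr_eq0;
    apply/eqP.
  apply: eq_bigr => i _; congr (_ * _).
  under eq_bigr do rewrite -exprD.
  under [RHS]eq_bigr do rewrite -exprD.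
  apply: (unity_root_sum_conj w_prim) => //.
  rewrite Dn coprimeMr; apply/andP; split.
    by rewrite -coprime_modl addnC mulnC modnMDl e_m coprime_modl coprime1n.
  rewrite coprime_sym prime_coprime // dvdn_addr // Gauss_dvdr 1?coprime_sym //.
  by rewrite gtnNdvd // /bump leq0n -ltn_predRL.
have q_dv q p' : (forall q, prime q -> (q %| n)%N -> (p' <= q)%N) -> prime q ->
  (q %| m)%N -> (p' <= q)%N.
  by move=> h q_pr q_m; apply: h => //; rewrite Dn dvdn_mulr.
(* If [d] vanishes, the images under u^e of the fibre of [v] in [s] and in [t] have equal sums;
   injectivity on the fibre keeps them disjoint. *)
have [d0|d_neq0] := eqVneq (d 0%N) 0.
  have := IH m m_lt p (w ^+ P) (g jv s) (g jv t) m_prim.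
  rewrite !size_map => h; apply: leq_trans (h _ _ _ _ _ _) _ => {h} //; last 1 first.
  - by rewrite geq_max !leq_max !size_f orbT.
  - by move=> q; apply: q_dv.
  - exact: g1.
  - exact: g1.
  - move=> _ /mapP[u us ->]; apply/negP => /mapP[u' u't uu'].
    move: us u't; rewrite !mem_filter => /andP[u_x us] /andP[u'_x u't].
    have /(_ _ _ uu') := g_inj jv u u'.
    rewrite !inE u_x u'_x (allP s1) // (allP t1) // => /(_ isT isT) E.
    by have := st_disj u us; rewrite E u't.
  - by apply/eqP; rewrite -subr_eq0 -/(d jv) d_const d0.
(* Fewer than p <= P elements miss one of the P fibres. *)
have empty_fibre r : all n.-unity_root r -> (size r < p)%N ->
  exists i : 'I_P, size (f i r) = 0%N.
  move=> r1 r_p; suff /existsP[i /eqP ri] : [exists i :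
    'I_P, size (f i r) == 0%N] by exists i.
  apply: contraTT r_p; rewrite negb_exists => /forallP h.
  rewrite -leqNgt; apply: leq_trans p_le _.
  rewrite -(sum_size_filter_prim_root x_prim (m := m)) -?Dn //.
  rewrite -{1}[P]card_ord -sum1_card; apply: leq_sum => i _.
  by rewrite lt0n; exact: h.
have [//|] := leqP p (maxn (size s) (size t)); rewrite gtn_max => /andP[s_p t_p].
have [i ti] := empty_fibre t t1 t_p.
have [j sj] := empty_fibre s s1 s_p.
suff: (p <= maxn (\sum_(k < P) size (f k s)) (\sum_(k < P) size (f k t)))%N.
  by rewrite !(sum_size_filter_prim_root x_prim) -?Dn // leqNgt gtn_max s_p t_p.
apply: (@box_count P p _ _ i j) => //.
  (* A fibre empty in both lists would make [d] vanish. *)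
  move=> k; rewrite lt0n addn_eq0; apply: contra d_neq0 => /andP[/nilP sk /nilP tk].
  by rewrite -(d_const k) /d /g sk tk subrr.
(* As [f i t] and [f j s] are empty, [g i s] has sum d and [g j t] has sum -d; their concatenation
   has sum 0 and is compared with the empty list. *)
have := IH m m_lt p.+1 (w ^+ P) (g i s ++ g j t) [::] m_prim.
rewrite size_cat maxn0 !size_map; apply => //.
(* P is the least prime of n and does not divide m: the bound p + 1 holds for m. *)
- by move=> q q_pr q_m; apply: leq_ltn_trans p_le _; exact: pdiv_cofactor_le.
- by rewrite all_cat !g1.
- have := d_neq0; rewrite -(d_const i) addn0 !lt0n; apply: contra;
  rewrite addn_eq0 => /andP[/nilP si _].
  by rewrite /d /g si (nilP (introT eqP ti)) subrr.
rewrite big_cat big_nil /=.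
have := d_const i; rewrite -(d_const j) /d /g (nilP (introT eqP ti)) (nilP (introT
  eqP sj)) !big_nil subr0 sub0r => ->.
by rewrite addNr.
Qed.

(** * Subsets of the roots of unity with equal sums *)

Definition equal_subset_sums (F : fieldType) (n k : nat) (w : F) : Prop :=
  exists I J : {set 'I_n}, [/\ #|I| = k, #|J| = k, I != J &
    \sum_(i in I) w ^+ i = \sum_(i in J) w ^+ i].

Lemma subset_of_card (T : finType) (A : {set T}) m :
  (m <= #|A|)%N -> exists2 B : {set T}, B \subset A & #|B| = m.
Proof.
move=> mA; exists [set x in take m (enum A)].
  by apply/subsetP => x; rewrite inE => /mem_take; rewrite mem_enum.
rewrite cardsE; have /card_uniqP ->
  : uniq (take m (enum A)) by rewrite take_uniq ?enum_uniq.
by rewrite size_take -cardE; case: ltngtP mA.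
Qed.

(** Dropping the common part of I and J leaves disjoint sets of equal size and equal sum, hence of
    at least [pdiv n] elements each; one lies in I, of size k, the other in its complement, of size
    n - k. *)
Lemma equal_subset_sums_pdiv_bounds (F : numFieldType) n k (w : F) :
  n.-primitive_root w -> equal_subset_sums n k w -> (pdiv n <= k <= n - pdiv n)%N.
Proof.
move=> w_prim [I [J [cardI cardJ IJ sumIJ]]].
pose r (A : {set 'I_n}) := [seq w ^+ (i : nat) | i : 'I_n <- enum A].
have r1 A : all n.-unity_root (r A).
  apply/allP => _ /mapP[i _ ->]; apply/unity_rootP.
  by rewrite -exprM mulnC exprM (prim_expr_order w_prim) expr1n.
have size_r A : size (r A) = #|A| by rewrite size_map cardE.
have sum_r A : \sum_(u <- r A) u = \sum_(i in A) w ^+ i by rewrite big_map big_enum.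
have cardD : #|I :\: J| = #|J :\: I|.
  by apply/eqP; rewrite -(eqn_add2l #|I :&: J|) cardsID cardI -cardJ setIC cardsID.
have D_gt0 : (0 < #|I :\: J|)%N.
  rewrite card_gt0 setD_eq0; apply: contra IJ => sIJ.
  by rewrite eqEcard sIJ cardI cardJ leqnn.
have : (pdiv n <= maxn (size (r (I :\: J))) (size (r (J :\: I))))%N.
  apply: (unity_root_sum_size w_prim) => //.
  - by move=> q q_pr q_n; exact: pdiv_min_dvd (prime_gt1 q_pr) q_n.
  - move=> _ /mapP[i + ->]; rewrite mem_enum !inE => /andP[iJ iI].
    apply/negP => /mapP[j + /eqP]; rewrite mem_enum !inE (eq_prim_root_expr w_prim).
    rewrite !modn_small // (inj_eq val_inj) => /andP[_ jJ] /eqP ij.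
    by rewrite ij jJ in iJ.
  - by rewrite !size_r; lia.
  - rewrite !sum_r; move: sumIJ; rewrite (big_setID J) (big_setID (A := J) I) /= setIC.
    exact: addrI.
rewrite !size_r -cardD maxnn => p_le.
have le_k : (#|I :\: J| <= k)%N by rewrite -cardI subset_leq_card ?subsetDl.
have : (#|I :\: J| <= n - k)%N.
  have <- : #|~: I| = (n - k)%N by have := cardsC I; rewrite card_ord cardI; lia.
  rewrite cardD; apply: subset_leq_card.
  by apply/subsetP => x; rewrite !inE => /andP[].
have : (#|I| <= n)%N by rewrite -[X in (_ <= X)%N]card_ord max_card.
rewrite cardI; lia.
Qed.

(** With n = d p, the exponents d i + r for fixed r form a coset of the p-th roots of unity, with
    sum 0. The cosets of r = 0 and r = 1, completed by the same k - p other exponents, are the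
    required subsets. *)
Lemma pdiv_bounds_equal_subset_sums (F : numFieldType) n k (w : F) :
  (0 < k)%N -> n.-primitive_root w -> (pdiv n <= k <= n - pdiv n)%N ->
    equal_subset_sums n k w.
Proof.
move=> k_gt0 w_prim /andP[p_le_k k_le].
set p := pdiv n in p_le_k k_le *; pose d := (n %/ p)%N.
have p_gt0 : (0 < p)%N by exact: pdiv_gt0.
have n_gt1 : (1 < n)%N by lia.
have p_gt1 : (1 < p)%N by apply: prime_gt1; exact: pdiv_prime.
have Dn : (d * p = n)%N by rewrite divnK ?pdiv_dvd.
(* If d were 1, then n = p and p <= k <= n - p would fail. *)
have d_gt1 : (1 < d)%N by move: Dn; case: d => [|[|d']] //; lia.
have w_d : p.-primitive_root (w ^+ d) by have := dvdn_prim_root w_prim (pdiv_dvd n).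
have lt_f (r : nat) (rd : (r < d)%N) (i : 'I_p) : (d * i + r < n)%N.
  by have := ltn_ord i; rewrite -Dn; nia.
pose f r rd i := Ordinal (@lt_f r rd i).
have f_inj r rd : injective (@f r rd).
  move=> i j /(congr1 val) /= /eqP; rewrite eqn_add2r eqn_pmul2l; last by lia.
  by move/eqP/val_inj.
pose A r rd := [set @f r rd i | i : 'I_p].
have cardA r rd : #|@A r rd| = p by rewrite card_imset ?card_ord.
have sumA r rd : \sum_(i in @A r rd) w ^+ i = 0.
  rewrite big_imset /=; last by move=> i j _ _; exact: f_inj.
  under eq_bigr do rewrite exprD exprM.
  rewrite -mulr_suml (sum_expr_unity_root (prim_expr_order w_d)) ?mul0r //.
  by rewrite -[w ^+ d]expr1 -(expr0 (w ^+ d)) (eq_prim_root_expr w_d) !modn_small.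
pose A0 := @A 0%N (ltnW d_gt1); pose A1 := @A 1%N d_gt1.
have disj i : i \in A0 -> i \in A1 -> False.
  move=> /imsetP[i0 _ ->] /imsetP[i1 _ /(congr1 val) /= /(congr1 (modn^~ d))].
  by rewrite -!(mulnC (nat_of_ord _)) !modnMDl mod0n modn_small.
(* The complement of the two cosets has at least n - 2p >= k - p elements, because k <= n - p. *)
have [C CA cardC] : exists2 C : {set 'I_n}, C \subset ~: (A0 :|: A1) & #|C| = (k - p)%N.
  apply: subset_of_card; rewrite cardsCs setCK card_ord.
  have : (#|A0 :|: A1| <= p + p)%N
    by rewrite -{1}(cardA _ (ltnW d_gt1)) -(cardA _ d_gt1) leq_card_setU.
  by move/(leq_sub2l n); apply: leq_trans; rewrite subnDA leq_sub2r.
have CA0 i : i \in C -> i \notin A0 by move/(subsetP CA);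
  rewrite !inE negb_or => /andP[].
have CA1 i : i \in C -> i \notin A1 by move/(subsetP CA);
  rewrite !inE negb_or => /andP[].
have dj (B : {set 'I_n}) : (forall i, i \in C -> i \notin B) -> [disjoint B & C].
  by move=> h; rewrite disjoint_sym disjoint_subset; apply/subsetP => i /h.
have card_BC (B : {set 'I_n}) : [disjoint B & C] -> #|B| = p -> #|B :|: C| = k.
  by move=> h cB; rewrite cardsU (disjoint_setI0 h) cards0 cB cardC; lia.
exists (A0 :|: C), (A1 :|: C); split.
- by apply: card_BC; [exact: dj | exact: cardA].
- by apply: card_BC; [exact: dj | exact: cardA].
- have f0 : f 0%N (ltnW d_gt1) (Ordinal p_gt0) \in A0 by apply: imset_f.
  apply/negP => /eqP /setP /(_ (f 0%N (ltnW d_gt1) (Ordinal p_gt0))).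
  rewrite !inE f0 /= => /esym /orP[|/CA0]; last by rewrite f0.
  exact: disj.
have sumU (B : {set 'I_n}) : [disjoint B & C] ->
    \sum_(i in B :|: C) w ^+ i = \sum_(i in B) w ^+ i + \sum_(i in C) w ^+ i.
  by move=> h; rewrite -bigU //; apply: eq_bigl => i; rewrite !inE.
by rewrite !sumU ?dj //= !sumA.
Qed.

(** * Complete symmetric polynomials *)

Lemma mcoeffXM (R : comNzRingType) k (i : 'I_k) (f : {mpoly R[k]}) m :
  ('X_i * f)@_m = if m i == 0%N then 0 else f@_(m - U_(i)).
Proof.
rewrite {1}[f]mpolyE mulr_sumr raddf_sum /=.
under eq_bigr => b _ do rewrite -scalerAr -mpolyXD mcoeffZ mcoeffX.
case: ifP => [mi0|/negbT mi0].
  rewrite big1 // => b _; case: eqP => [bm|]; last by rewrite mulr0.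
  by move: mi0; rewrite -bm mnmDE mnm1E eqxx.
rewrite [in RHS](mpolyE f) raddf_sum /=; apply: eq_bigr => b _.
rewrite mcoeffZ mcoeffX; congr (_ * (nat_of_bool _)%:R).
apply/eqP/eqP => [<-|->]; first by rewrite addmC addmK.
by rewrite addmC submK // lep1mP.
Qed.

(** The complete symmetric polynomial h_j in the variables indexed by [S]. The relations bear on
    [setT]; the interpolation uses their consequences for one and two variables. *)
Definition completeS (R : comNzRingType) k (S : {set 'I_k}) (j : nat) : {mpoly R[k]} :=
  \sum_(m : 'X_{1..k < j.+1} | (mdeg m == j) && [forall i, (i \in S) || (m i == 0%N)])
    'X_[m].

Lemma mcoeff_completeS (R : comNzRingType) k (S : {set 'I_k}) j m :
  (completeS R S j)@_m =
  ((mdeg m == j) && [forall i, (i \in S) || (m i == 0%N)])%:R.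
Proof.
rewrite /completeS raddf_sum /=.
under eq_bigr => i _ do rewrite mcoeffX.
have [mP|mP] := boolP (_ && _); last first.
  by rewrite big1 // => i iP; case: eqP => // im; rewrite -im iP in mP.
have lt_m : (mdeg m < j.+1)%N by have /andP[/eqP ->] := mP.
rewrite (bigD1 (BMultinom lt_m)) //= eqxx big1 ?addr0 // => i.
case/andP=> _ ne; case: eqP => // im; case/eqP: ne.
exact/val_inj.
Qed.

Lemma completeS0 (R : comNzRingType) k (S : {set 'I_k}) : completeS R S 0 = 1.
Proof.
apply/mpolyP => m; rewrite mcoeff_completeS mcoeff1 mdeg_eq0.
case: eqP => //= ->; rewrite (introT forallP) // => i.
by rewrite mnm0E orbT.
Qed.

Lemma completeS_set0 (R : comNzRingType) k j : completeS R (@set0 'I_k) j.+1 = 0.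
Proof.
apply/mpolyP => m; rewrite mcoeff_completeS mcoeff0;
  case: andP => // -[/eqP mj /forallP m0].
move: mj; rewrite mdegE big1 // => i _.
by have := m0 i; rewrite inE => /eqP.
Qed.

(** A monomial of degree j + 1 either avoids x_i or is x_i times a monomial of degree j in which x_i
    may still occur. *)
Lemma completeSU (R : comNzRingType) k (S : {set 'I_k}) (i : 'I_k) j :
  i \notin S ->
  completeS R (i |: S) j.+1 = completeS R S j.+1 + 'X_i * completeS R (i |: S) j.
Proof.
move=> iS; apply/mpolyP => m.
rewrite mcoeffD mcoeffXM !mcoeff_completeS.
have [mi0|mi0] := eqVneq (m i) 0%N.
  rewrite addr0; congr ((_ && _ : bool)%:R); apply: eq_forallb => l.
  by rewrite !inE; have [->|] := eqVneq l i; rewrite //= mi0 orbT.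
have -> : [forall l, (l \in S) || (m l == 0%N)] = false.
  by apply/negbTE/forallPn; exists i; rewrite negb_or iS.
rewrite andbF add0r; congr ((_ && _ : bool)%:R).
  have {1}<- : (m - U_(i) + U_(i))%MM = m by rewrite submK // lep1mP.
  by rewrite mdegD mdeg1 addn1 eqSS.
apply: eq_forallb => l; rewrite !inE mnmBE mnm1E.
by have [->|li] := eqVneq l i; rewrite //= subn0.
Qed.

(* Applied to the images of completeS under a projection to a quotient ring and
   under the evaluation at a point. *)
Section Recursion.
Variables (B : comPzRingType) (k : nat) (h : {set 'I_k} -> nat -> B) (x : 'I_k -> B).
Hypotheses (h0 : forall S, h S 0 = 1) (h_set0 : forall j, h set0 j.+1 = 0).
Hypothesis hU : forall (S : {set 'I_k}) i j,
  i \notin S -> h (i |: S) j.+1 = h S j.+1 + x i * h (i |: S) j.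

Lemma rec_set1 i j : h [set i] j = x i ^+ j.
Proof.
elim: j => [|j IH]; first by rewrite h0.
have := @hU set0 i j; rewrite inE setU0 => -> //.
by rewrite h_set0 add0r IH exprS.
Qed.

Lemma rec_set2_eigen i j (z e : B) m : i != j -> x i * e = z * e -> x j * e = z * e ->
  h [set i; j] m * e = m.+1%:R * z ^+ m * e.
Proof.
move=> ij xi xj.
have xX l a : x l * e = z * e -> x l ^+ a * e = z ^+ a * e.
  move=> xl; elim: a => [|a IHa]; first by rewrite !expr0.
  by rewrite exprSr -mulrA xl mulrCA IHa mulrA -exprS.
elim: m => [|m IH]; first by rewrite h0 expr0 !mul1r.
rewrite hU ?inE // rec_set1 mulrDl xX // -mulrA IH mulrCA xi.
rewrite mulrA -[_ * _ * z]mulrA -exprSr -mulrDl; congr (_ * e).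
by rewrite [m.+2%:R]mulrS mulrDl mul1r.
Qed.

(** Induction on the number of variables missing from [S]. Removing x_i costs one vanishing degree
    at the bottom, and h_n is unchanged because h_(n-1) of the larger set is zero. *)
Lemma rec_descend n (c : B) : (k <= n)%N ->
  (forall j, (n - k < j < n)%N -> h setT j = 0) -> h setT n = c ->
  forall S : {set 'I_k}, (0 < #|S|)%N ->
    (forall j, (n - #|S| < j < n)%N -> h S j = 0) /\ h S n = c.
Proof.
move=> kn hT0 hTc S; have [s] := ubnP (k - #|S|); elim: s S => // s IH S lt_s S_gt0.
have [->|/eqP ST] := eqVneq S setT; first by rewrite cardsT card_ord.
have [i iS] : exists i, i \notin S.
  by apply/existsP; rewrite -negb_forall; apply: contra_notN ST => /forallP ST;
    apply/setP => i; rewrite ST inE.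
have cU : #|i |: S| = #|S|.+1 by rewrite cardsU1 iS.
have S_k : (#|i |: S| <= k)%N by rewrite -[X in (_ <= X)%N]card_ord max_card.
rewrite cU in S_k.
have [hU0 hUc] : (forall j, (n - #|S|.+1 < j < n)%N ->
  h (i |: S) j = 0) /\ h (i |: S) n = c.
  by rewrite -cU; apply: IH; rewrite cU; lia.
have hE j : h S j.+1 = h (i |: S) j.+1 - x i * h (i |: S) j by rewrite hU // addrK.
split=> [[|j] j_n|]; first by lia.
  by rewrite hE !hU0 ?mulr0 ?subr0 //; lia.
have -> : n = n.-1.+1 by lia.
by rewrite hE prednK ?hUc ?hU0 ?mulr0 ?subr0 //; lia.
Qed.

End Recursion.

(** Induction on the size of [S]. Expanding h_(m+1)(S) along i and along j gives (x_i - x_j) h_m(S)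
    = h_(m+1)(S \ j) - h_(m+1)(S \ i), where the right side is 0 - 0, or c - c when m + 1 = n. *)
Lemma rec_vanish (F : fieldType) k (h : {set 'I_k} -> nat -> F) (x : 'I_k ->
  F) n (c : F) :
  (forall S, h S 0 = 1) -> (forall j, h set0 j.+1 = 0) ->
  (forall (S : {set 'I_k}) i j,
    i \notin S -> h (i |: S) j.+1 = h S j.+1 + x i * h (i |: S) j) ->
  injective x -> (forall i, x i ^+ n = c) -> (k <= n)%N ->
  forall S : {set 'I_k}, (0 < #|S|)%N ->
    (forall j, (n - #|S| < j < n)%N -> h S j = 0) /\ h S n = c.
Proof.
move=> h0 h_set0 hU x_inj xn kn S; have [s] := ubnP #|S|;
  elim: s S => // s IH S lt_s S_gt0.
have [i iS] := card_gt0P S_gt0.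
have cDi := cardsD1 i S; rewrite iS in cDi.
have [/eqP|Si_gt0] := posnP #|S :\ i|.
  rewrite cards_eq0 => /eqP Si.
  have -> : S = [set i] by rewrite -(setD1K iS) Si setU0.
  by rewrite cards1; split; [move=> j; lia | rewrite (rec_set1 h0 h_set0 hU)].
have [j] := card_gt0P Si_gt0; rewrite !inE => /andP[ji jS].
have cDj := cardsD1 j S; rewrite jS in cDj.
have S_k : (#|S| <= k)%N by rewrite -[X in (_ <= X)%N]card_ord max_card.
have [hi0 hic] : (forall m, (n - #|S :\ i| < m < n)%N ->
  h (S :\ i) m = 0) /\ h (S :\ i) n = c.
  by apply: IH; lia.
have [hj0 hjc] : (forall m, (n - #|S :\ j| < m < n)%N ->
  h (S :\ j) m = 0) /\ h (S :\ j) n = c.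
  by apply: IH; lia.
have hE l m : l \in S -> h S m.+1 = h (S :\ l) m.+1 + x l * h S m.
  by move=> lS; rewrite -{1}(setD1K lS) hU ?setD11 // setD1K.
have hS0 m : (n - #|S| < m < n)%N -> h S m = 0.
  move=> m_n; have : (x i - x j) * h S m = 0.
    transitivity (h (S :\ j) m.+1 - h (S :\ i) m.+1).
      apply/eqP; rewrite mulrBl subr_eq addrAC eq_sym subr_eq eq_sym.
      by rewrite [_ + h (S :\ i) _]addrC -!hE.
    have [->|mn] := eqVneq m.+1 n; first by rewrite hic hjc subrr.
    by rewrite hi0 ?hj0 ?subrr //; lia.
  move/eqP; rewrite mulf_eq0 subr_eq0 (inj_eq x_inj) [i == j]eq_sym (negPf ji).
  by move/eqP.
split=> //.
have -> : n = n.-1.+1 by lia.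
by rewrite (hE i) // prednK ?hic ?hS0 ?mulr0 ?addr0 //; lia.
Qed.

(** * Interpolation at the roots of z^n = r^n *)

Section Kernel.
Variables (K : numFieldType) (B : comPzRingType) (k n : nat) (w r : K).
Variable (phi : {rmorphism {mpoly K[k]} -> B}).
Hypotheses (w_prim : n.-primitive_root w) (r_neq0 : r != 0) (k_le : (k <= n)%N).
Hypothesis phi0 : forall j, (n - k < j < n)%N -> phi (completeS K setT j) = 0.
Hypothesis phic : phi (completeS K setT n) = phi (r ^+ n)%:MP.

Let n_gt0 : (0 < n)%N. Proof. exact: prim_order_gt0 w_prim. Qed.
Let n_neq0 : n%:R != 0 :> K. Proof. by rewrite pnatr_eq0 -lt0n. Qed.
Let C (a : K) : B := phi a%:MP.
Let x (i : 'I_k) : B := phi 'X_i.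
Let z (l : 'I_n) : K := r * w ^+ l.
Let h S j := phi (completeS K S j).

Let CM a b : C (a * b) = C a * C b. Proof. by rewrite /C mpolyCM rmorphM. Qed.
Let C1 : C 1 = 1. Proof. by rewrite /C mpolyC1 rmorph1. Qed.
Let C0 : C 0 = 0. Proof. by rewrite /C mpolyC0 rmorph0. Qed.
Let CX a m : C (a ^+ m) = C a ^+ m.
Proof. by elim: m => [|m IH]; rewrite ?expr0 ?C1 // !exprS CM IH. Qed.
Let Csum (I : finType) (F : I -> K) : C (\sum_i F i) = \sum_i C (F i).
Proof. by rewrite /C !raddf_sum. Qed.

Let w_neq0 : w != 0.
Proof. by rewrite (prim_root_eq0 w_prim) -lt0n. Qed.
Let z_neq0 l : z l != 0. Proof. by rewrite mulf_neq0 ?expf_neq0. Qed.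
Let zn l : z l ^+ n = r ^+ n.
Proof. by rewrite exprMn -exprM mulnC exprM (prim_expr_order w_prim) expr1n mulr1. Qed.

Let h0 S : h S 0 = 1. Proof. by rewrite /h completeS0 rmorph1. Qed.
Let h_set0 j : h set0 j.+1 = 0. Proof. by rewrite /h completeS_set0 rmorph0. Qed.
Let hU (S : {set 'I_k}) i j :
  i \notin S -> h (i |: S) j.+1 = h S j.+1 + x i * h (i |: S) j.
Proof. by move=> iS; rewrite /h completeSU // rmorphD rmorphM. Qed.

Let xn i : x i ^+ n = C (r ^+ n).
Proof.
rewrite -(rec_set1 h0 h_set0 hU).
by apply: (rec_descend hU k_le phi0 phic _).2; rewrite cards1.
Qed.

Let h2 i j : i != j -> h [set i; j] n.-1 = 0.
Proof.
move=> ij; apply: (rec_descend hU k_le phi0 phic _).1; first by rewrite cards2 ij.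
have : (#|[set i; j]| <= k)%N by rewrite -[X in (_ <= X)%N]card_ord max_card.
by rewrite cards2 ij /=; lia.
Qed.

(* The Lagrange interpolation idempotent of the root z l, evaluated at x i. *)
Let E (l : 'I_n) (i : 'I_k) : B := C n%:R^-1 * \sum_(a < n) (C (z l)^-1 * x i) ^+ a.

(** With y = x_i / z_l, multiplying the geometric sum by y - 1 gives y^n - 1 = 0, so y fixes
    [E l i]. *)
Let xE l i : x i * E l i = C (z l) * E l i.
Proof.
set y := C (z l)^-1 * x i.
have yn : y ^+ n = 1.
  by rewrite exprMn -CX xn -CM exprVn zn mulVf ?C1 // expf_neq0.
have yE : y * E l i = E l i.
  apply/eqP; rewrite -subr_eq0 -{2}[E l i]mul1r -mulrBl /E mulrCA -subrX1 yn subrr.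
  by rewrite mulr0.
by rewrite -{2}yE mulrA /y mulrA -CM divff // C1 mul1r.
Qed.

(** After exchanging the sums, the coefficient of x_i^a is 1/n times the sum over l of z_l^(-a),
    which is n for a = 0 and zero for 0 < a < n. *)
Let sumE i : \sum_l E l i = 1.
Proof.
rewrite -mulr_sumr exchange_big /=.
transitivity (C n%:R^-1 * \sum_(a < n) C (if a == 0%N :> nat then n%:R else 0) * x i
  ^+ a).
  congr (_ * _); apply: eq_bigr => a _.
  under eq_bigr do rewrite exprMn -CX.
  rewrite -mulr_suml -Csum; congr (C _ * _).
  have [->|a_neq0] := eqVneq (a : nat) 0%N.
    by under eq_bigr do rewrite expr0; rewrite sumr_const card_ord.
  under eq_bigr do rewrite invfM exprMn -exprVn -exprM mulnC exprM.
  rewrite -mulr_sumr sum_expr_unity_root ?mulr0 //.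
    by rewrite -exprM mulnC exprM exprVn (prim_expr_order w_prim) invr1 expr1n.
  rewrite exprVn invr_eq1 -[X in _ != X](expr0 w) (eq_prim_root_expr w_prim).
  by rewrite !modn_small.
have <- : C n%:R^-1 * C n%:R = 1 by rewrite -CM mulVf ?C1.
congr (_ * _); rewrite (bigD1 (Ordinal n_gt0)) //= expr0 mulr1 big1 ?addr0 // => a a0.
by rewrite (negPf (_ : (a : nat) != 0%N)) ?C0 ?mul0r.
Qed.

Let xX i m : x i ^+ m = \sum_l C (z l ^+ m) * E l i.
Proof.
rewrite -[LHS]mulr1 -(sumE i) mulr_sumr; apply: eq_bigr => l _.
elim: m => [|m IH]; first by rewrite !expr0 C1.
by rewrite exprSr -mulrA xE mulrCA IH mulrA -CM -exprS.
Qed.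

(** The product is an eigenvector of x_i and x_j for the same z_l, so h_(n-1)(x_i, x_j) = 0 acts on
    it as n z_l^(n-1), an invertible constant. *)
Let EE i j l : i != j -> E l i * E l j = 0.
Proof.
move=> ij; set e := E l i * E l j.
have xi : x i * e = C (z l) * e by rewrite /e mulrA xE mulrA.
have xj : x j * e = C (z l) * e by rewrite /e mulrCA xE mulrCA.
have := rec_set2_eigen h0 h_set0 hU n.-1 ij xi xj.
rewrite h2 // mul0r prednK // -CX.
have -> : n%:R = C n%:R by rewrite /C !raddfMn /= mpolyC1 rmorph1.
rewrite -CM => /(congr1 ( *%R (C (n%:R * z l ^+ n.-1)^-1))).
by rewrite mulr0 mulrA -CM mulVf ?C1 ?mul1r // mulf_neq0 ?expf_neq0.
Qed.

(** In each monomial the powers of the x_i are expanded over the [E l i]; distributing the product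
    over i gives a sum over all maps u. *)
Lemma interpolation f :
  phi f = \sum_(u : {ffun 'I_k -> 'I_n}) C f.@[fun i => z (u i)] * \prod_i E (u i) i.
Proof.
rewrite {1}[f]mpolyE rmorph_sum /=.
have mono (m : 'X_{1..k}) : phi 'X_[m] =
    \sum_(u : {ffun 'I_k -> 'I_n}) C (\prod_i z (u i) ^+ m i) * \prod_i E (u i) i.
  rewrite mpolyXE_id rmorph_prod; under eq_bigr do rewrite rmorphXn -/(x _) xX.
  rewrite bigA_distr_bigA; apply: eq_bigr => u _; rewrite big_split /=; congr (_ * _).
  by rewrite (big_morph C CM C1).
transitivity (\sum_(m <- msupp f) \sum_(u : {ffun 'I_k -> 'I_n})
    C (f@_m * \prod_i z (u i) ^+ m i) * \prod_i E (u i) i).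
  apply: eq_bigr => m _; rewrite -mul_mpolyC rmorphM /= mono mulr_sumr.
  by apply: eq_bigr => u _; rewrite CM mulrA.
rewrite exchange_big /=; apply: eq_bigr => u _.
by rewrite -mulr_suml mevalE /C !raddf_sum.
Qed.

Lemma kernel_interpolation f :
  (forall u : 'I_k -> 'I_n, injective u -> f.@[fun i => r * w ^+ u i] = 0) -> phi f = 0.
Proof.
move=> f0; rewrite interpolation big1 // => u _.
have [/injectiveP u_inj|/injectivePn[i [j ij uij]]] := boolP (injectiveb u).
  by rewrite f0 // C0 mul0r.
by rewrite (bigD1 i) //= (bigD1 j) 1?eq_sym //= mulrA uij [E _ i * _]EE // mul0r mulr0.
Qed.

End Kernel.

(** * The spectrum of the quotient algebra *)

Section DiagonalSpectrum.
Variables (K : fieldType) (V : lmodType K) (T : finType) (L : {linear V -> V}).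
Variables (b : T -> V) (lam : T -> K).
Hypothesis b_span : forall v, exists a : T -> K, v = \sum_i a i *: b i.
Hypothesis b_free : forall a : T -> K, \sum_i a i *: b i = 0 -> forall i, a i = 0.
Hypothesis b_eigen : forall i, L (b i) = lam i *: b i.

Let b' (j : 'I_#|T|) := b (enum_val j).

Let sum_enum (a : 'I_#|T| -> K) :
  \sum_j a j *: b' j = \sum_i a (enum_rank i) *: b i.
Proof.
rewrite (reindex (@enum_rank T)) /=; last first.
  by exists enum_val => i _; rewrite ?enum_rankK ?enum_valK.
by apply: eq_bigr => i _; rewrite /b' enum_rankK.
Qed.

Lemma diag_is_basis : is_basis b'.
Proof.
move=> v; have [a Da] := b_span v.
exists (\row_j a (enum_val j)); split=> [|c Dc].
  by rewrite sum_enum Da; apply: eq_bigr => i _; rewrite mxE enum_rankK.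
apply/rowP => j; rewrite mxE; apply/eqP; rewrite -subr_eq0.
have <- := @b_free (fun i => a i - c 0 (enum_rank i)) _ (enum_val j).
  by rewrite enum_valK.
under eq_bigr do rewrite scalerBl.
by rewrite sumrB -Da Dc sum_enum subrr.
Qed.

Lemma diag_eigenvalues :
  eigenvalues_of L [seq lam (enum_val j) | j <- enum 'I_#|T|].
Proof.
exists #|T|, b', (diag_mx (\row_j lam (enum_val j))); split.
- exact: diag_is_basis.
- move=> i; rewrite (bigD1 i) //= big1 ?addr0 => [|j ji].
    by rewrite b_eigen !mxE eqxx mulr1n.
  by rewrite !mxE eq_sym (negPf ji) mulr0n scale0r.
rewrite char_poly_trig ?diag_mx_is_trig // big_map big_enum /=.
by apply: eq_bigr => j _; rewrite !mxE eqxx mulr1n.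
Qed.

(** [s] may come from another basis, of size N. Comparing the bases gives N <= #|T|; every [lam i]
    is a root of the characteristic polynomial, so #|T| distinct values fill a list of size N. *)
Lemma simple_spectrum_uniq s : injective lam -> eigenvalues_of L s -> uniq s.
Proof.
move=> lam_inj [N [e [M [e_basis eM charM]]]].
have e_uniq (a c : 'rV[K]_N) :
    \sum_(i < N) a 0 i *: e i = \sum_(i < N) c 0 i *: e i -> a = c.
  move=> ac; have [d [_ d_uniq]] := e_basis (\sum_(i < N) a 0 i *: e i).
  by rewrite -(d_uniq a) // -(d_uniq c).
have /fin_all_exists[A DA] :
    forall i, exists a : 'rV[K]_N, b i = \sum_(j < N) a 0 j *: e j.
  by move=> i; have [a [? _]] := e_basis (b i); exists a.
have /fin_all_exists[C DC] :
    forall j, exists a : 'rV[K]_#|T|, e j = \sum_i a 0 i *: b' i.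
  by move=> i; have [a [? _]] := diag_is_basis (e i); exists a.
have N_le : (N <= #|T|)%N.
  apply: (@mulmx1_min _ _ _ (\matrix_(j, i) C j 0 i) (\matrix_(i, j) A (enum_val i)
    0 j)).
  apply/row_matrixP => j; rewrite row1; apply: e_uniq.
  rewrite [RHS](bigD1 j) //= [X in _ + X]big1 ?addr0 => [|l lj]; last first.
    by rewrite mxE eqxx (negPf lj) scale0r.
  rewrite mxE !eqxx scale1r [RHS]DC.
  under [RHS]eq_bigr do rewrite /b' DA scaler_sumr.
  rewrite exchange_big /=; apply: eq_bigr => l _.
  rewrite !mxE scaler_suml; apply: eq_bigr => i _.
  by rewrite !mxE scalerA.
have size_s : size s = N.
  by have := size_prod_XsubC s id; rewrite -charM size_char_poly => -[].
apply: (@leq_size_uniq _ [seq lam i | i : T]).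
- by rewrite map_inj_uniq ?enum_uniq.
- move=> _ /codomP[i ->]; rewrite -root_prod_XsubC -charM -eigenvalue_root_char.
  (* Under the row convention, the coordinate row of [b i] is an eigenvector of [M]; it is nonzero
     by freeness. *)
  apply/eigenvalueP; exists (A i).
    apply: e_uniq.
    transitivity (L (b i)).
      rewrite [in RHS]DA linear_sum;
        under [RHS]eq_bigr do rewrite linearZ /= eM scaler_sumr.
      rewrite exchange_big /=; apply: eq_bigr => l _.
      by rewrite mxE scaler_suml; apply: eq_bigr => j _; rewrite scalerA.
    rewrite b_eigen DA scaler_sumr; apply: eq_bigr => l _.
    by rewrite mxE scalerA.
  apply/eqP => Ai0; have := oner_neq0 K.
  rewrite -(@b_free (fun l => (l == i)%:R) _ i) ?eqxx //.
  rewrite (bigD1 i) //= eqxx scale1r big1 ?addr0 => [|l /negPf ->];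
    last by rewrite scale0r.
  by rewrite DA Ai0 big1 // => j _; rewrite mxE scale0r.
by rewrite size_image size_s.
Qed.

Lemma nonuniq_eigenvaluesP :
  (exists s, eigenvalues_of L s /\ ~~ uniq s) <-> exists i j, i != j /\ lam i = lam j.
Proof.
split=> [[s [eig_s s_uniq]]|[i [j [ij lam_ij]]]].
  have: ~~ injectiveb lam.
    apply: contra s_uniq => /injectiveP lam_inj; exact: simple_spectrum_uniq eig_s.
  by case/injectivePn=> i [j ij lam_ij]; exists i, j.
exists [seq lam (enum_val l) | l <- enum 'I_#|T|]; split; first exact: diag_eigenvalues.
have -> : [seq lam (enum_val l) | l <- enum 'I_#|T|] =
  codom (lam \o @enum_val T T) by [].
apply/injectivePn; exists (enum_rank i), (enum_rank j).
  by rewrite (inj_eq enum_rank_inj).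
by rewrite /= !enum_rankK.
Qed.

End DiagonalSpectrum.

Local Open Scope quotient_scope.
Local Open Scope complex_scope.

(** * The projection to the quotient as a ring morphism *)

Section AlgQuotientMorphism.
Variables (K : fieldType) (A : comAlgType K) (gs : seq A).

Definition aq_pi (x : A) : alg_quot gs := \pi_(alg_quot gs) x.

Lemma aq_pi_zmod_morphism : zmod_morphism aq_pi.
Proof.
move=> x y; apply/eqP; rewrite eq_sym subr_eq; apply/eqP.
by rewrite /aq_pi -alg_quotD subrK.
Qed.

Lemma aq_pi_monoid_morphism : monoid_morphism aq_pi.
Proof. by split=> // x y; rewrite /aq_pi -aq_mulE. Qed.

HB.instance Definition _ :=
  GRing.isZmodMorphism.Build A (alg_quot gs) aq_pi aq_pi_zmod_morphism.
HB.instance Definition _ :=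
  GRing.isMonoidMorphism.Build A (alg_quot gs) aq_pi aq_pi_monoid_morphism.

Lemma aq_piZ c x : aq_pi (c *: x) = c *: aq_pi x.
Proof. by rewrite /aq_pi -aq_scaleE. Qed.

Lemma aq_pi_eq0 x : (aq_pi x == 0) = (x \in ideal_gen gs).
Proof.
rewrite -(rmorph0 aq_pi) /aq_pi alg_quotE subr0 //.
Qed.

(** Coefficients indexed by [nat], extended by 0, have a type that does not depend on [size gs],
    which matters when [gs] is mapped to another ring. *)
Lemma ideal_gen_natP (f : A) :
  (f \in ideal_gen gs) <-> exists a : nat -> A, f = \sum_(i < size gs) a i * gs`_i.
Proof.
split=> [/ideal_genP[a ->]|[a ->]]; last first.
  by apply/ideal_genP; exists (fun i => a i).
exists (fun i => oapp a 0 (insub i)); apply: eq_bigr => i _.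
by rewrite valK.
Qed.

Lemma mem_ideal_gen g : g \in gs -> g \in ideal_gen gs.
Proof.
move=> g_gs; apply/ideal_gen_natP; exists (fun i => (i == index g gs)%:R).
have lt_g : (index g gs < size gs)%N by rewrite index_mem.
rewrite (bigD1 (Ordinal lt_g)) //= eqxx mul1r nth_index // big1 ?addr0 // => i.
by rewrite -(inj_eq val_inj) /= => /negPf ->; rewrite mul0r.
Qed.

End AlgQuotientMorphism.

Section SympolyVal.
Variables (K : fieldType) (k : nat).

Lemma sympoly_val_zmod_morphism : zmod_morphism (@sympoly_val k K).
Proof. exact: (raddfB (val : sympoly k K -> _)). Qed.

Lemma sympoly_val_monoid_morphism : monoid_morphism (@sympoly_val k K).
Proof.
split; first exact: (rmorph1 (val : sympoly k K -> _)).
exact: (rmorphM (val : sympoly k K -> _)).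
Qed.

Lemma sympoly_val_scalable : scalable (@sympoly_val k K).
Proof. by move=> a f; exact: (linearZ_LR (val : sympoly k K -> _)). Qed.

HB.instance Definition _ := GRing.isZmodMorphism.Build
  (sympoly k K) {mpoly K[k]} (@sympoly_val k K) sympoly_val_zmod_morphism.
HB.instance Definition _ := GRing.isMonoidMorphism.Build
  (sympoly k K) {mpoly K[k]} (@sympoly_val k K) sympoly_val_monoid_morphism.
HB.instance Definition _ := GRing.isScalable.Build
  K (sympoly k K) {mpoly K[k]} *:%R (@sympoly_val k K) sympoly_val_scalable.

End SympolyVal.

(** * Averaging over the symmetric group *)

Section Reynolds.
Variables (K : numFieldType) (k : nat).

Definition reynolds (f : {mpoly K[k]}) : {mpoly K[k]} :=
  (k`!)%:R^-1 *: \sum_(s : 'S_k) msym s f.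

Lemma reynolds_sym f : reynolds f \is @symmetric k K.
Proof.
apply/issymP => t; rewrite /reynolds msymZ [msym t _]raddf_sum; congr (_ *: _).
rewrite [RHS](reindex_inj (mulIg t)); apply: eq_bigr => s _ /=.
by rewrite msymMm.
Qed.

Lemma reynoldsM_sym f g : g \is @symmetric k K -> reynolds (f * g) = reynolds f * g.
Proof.
move=> /issymP g_sym; rewrite /reynolds -scalerAl mulr_suml; congr (_ *: _).
by apply: eq_bigr => s _; rewrite msymM g_sym.
Qed.

Lemma reynolds_id f : f \is @symmetric k K -> reynolds f = f.
Proof.
move=> /issymP f_sym; rewrite /reynolds.
under eq_bigr do rewrite f_sym.
rewrite sumr_const card_Sn -scaler_nat scalerA mulVf ?scale1r //.
by rewrite pnatr_eq0 -lt0n fact_gt0.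
Qed.

Lemma reynolds_is_zmod_morphism : zmod_morphism reynolds.
Proof.
by move=> f g; rewrite /reynolds -scalerBr -sumrB; under eq_bigr do rewrite raddfB.
Qed.
HB.instance Definition _ :=
  GRing.isZmodMorphism.Build {mpoly K[k]} {mpoly K[k]} reynolds
    reynolds_is_zmod_morphism.

(** Averaging an expression of f as the sum of the a_i g_i fixes f and the g_i and makes each a_i
    symmetric. *)
Lemma sympoly_ideal_gen (gs : seq (sympoly k K)) (f : sympoly k K) :
  sympoly_val f \in ideal_gen [seq sympoly_val g | g <- gs] -> f \in ideal_gen gs.
Proof.
move/ideal_gen_natP => [a Df]; apply/ideal_gen_natP.
exists (fun i => SymPoly (reynolds_sym (a i))); apply: val_inj.
rewrite raddf_sum /= -(reynolds_id (sympolyP f)) Df size_map raddf_sum.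
apply: eq_bigr => i _ /=; rewrite (nth_map 0) // reynoldsM_sym //; exact: sympolyP.
Qed.

End Reynolds.

Lemma complete_mpolyE (K : fieldType) k j : complete_mpoly k K j = completeS K setT j.
Proof.
apply/mpolyP => m; rewrite mcoeff_complete mcoeff_completeS.
by rewrite (introT forallP) ?andbT // => i; rewrite inE.
Qed.

Lemma meval_msym (R : comNzRingType) k (s : 'S_k) (f : {mpoly R[k]}) (v : 'I_k -> R) :
  (msym s f).@[v] = f.@[v \o s].
Proof.
rewrite /msym /mmap raddf_sum mevalE; apply: eq_bigr => m _ /=.
rewrite mevalM mevalC rmorph_prod; congr (_ * _); apply: eq_bigr => i _ /=.
by rewrite rmorphXn /= mevalXU.
Qed.

Lemma prod_sub_sym (R : comNzRingType) k (c : R) :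
  \prod_(i < k) ('X_i - c%:MP) \is @symmetric k R.
Proof.
apply/issymP => s; rewrite rmorph_prod [RHS](reindex_inj (@perm_inj _ s)).
apply: eq_bigr => i _ /=; rewrite rmorphB /=.
by rewrite /msym mmapX mmap1U mmapC.
Qed.

(** * Evaluation points, eigenbasis and eigenvalues *)

Section Points.
Variables (R : realType) (k n : nat) (q r w : R[i]).
Hypotheses (k_gt0 : (0 < k)%N) (k_lt : (k < n)%N).
Hypotheses (w_prim : n.-primitive_root w) (r_neq0 : r != 0).
Hypothesis rn : r ^+ n = (-1) ^+ k.-1 * q.

Local Notation K := R[i].
Let gs := qh_relations k n q.
Local Notation S := (sympoly k R[i]).
Let pt (u : 'I_k -> 'I_n) (i : 'I_k) : K := r * w ^+ u i.

Let evZ (a : K) (f : S) v : (sympoly_val (a *: f)).@[v] = a * (sympoly_val f).@[v].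
Proof. exact: mevalZ. Qed.

Let evM (f g : S) v :
  (sympoly_val (f * g)).@[v] = (sympoly_val f).@[v] * (sympoly_val g).@[v].
Proof. exact: mevalM. Qed.

Let pt_inj u : injective u -> injective (pt u).
Proof.
move=> u_inj i j /(mulfI r_neq0) /eqP; rewrite (eq_prim_root_expr w_prim).
by rewrite !modn_small // => /eqP /val_inj /u_inj.
Qed.

(** [rec_vanish] on the full set of variables shows that every relation vanishes at [pt u], whose
    coordinates are distinct n-th roots of r^n. *)
Lemma ideal_gen_meval (f : S) u :
  injective u -> f \in ideal_gen gs -> (sympoly_val f).@[pt u] = 0.
Proof.
move=> u_inj /ideal_gen_natP [a ->].
rewrite (raddf_sum (@sympoly_val k K)) raddf_sum /= big1 // => i _.
rewrite mevalM; apply/eqP; rewrite mulf_eq0; apply/orP; right.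
have : gs`_i \in gs by exact: mem_nth.
move: {i}gs`_i => g.
have [h0 hc] : (forall j, (n - #|[set: 'I_k]| < j < n)%N ->
  (completeS K setT j).@[pt u] = 0)
    /\ (completeS K setT n).@[pt u] = r ^+ n.
  apply: (@rec_vanish K k (fun A j => (completeS K A j).@[pt u]) (pt u)) => //.
  - by move=> ?; rewrite completeS0 meval1.
  - by move=> ?; rewrite completeS_set0 meval0.
  - by move=> ? ? ? ?; rewrite completeSU // mevalD mevalM mevalXU.
  - exact: pt_inj.
  - by move=> i; rewrite exprMn -exprM mulnC exprM (prim_expr_order w_prim) expr1n
    mulr1.
  - exact: ltnW.
  - by rewrite cardsT card_ord.
rewrite cardsT card_ord in h0.
rewrite mem_rcons inE => /orP[/eqP ->|/mapP[j]].
  rewrite (rmorphB (@sympoly_val k K)) /= complete_mpolyE mevalB hc.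
  transitivity (r ^+ n - (((-1) ^+ k.-1 * q) *: 1).@[pt u] == 0); first by [].
  by rewrite mevalZ meval1 mulr1 rn subrr eqxx.
rewrite mem_index_iota => j_n ->.
by rewrite /= complete_mpolyE h0 // eqxx.
Qed.

(** [kernel_interpolation] is applied in the quotient of the full polynomial ring by the same
    relations; [sympoly_ideal_gen] brings the result back to the symmetric polynomials. *)
Lemma aq_pi_vanish (f : S) :
  (forall u, injective u -> (sympoly_val f).@[pt u] = 0) -> aq_pi gs f = 0.
Proof.
move=> f0; apply/eqP; rewrite aq_pi_eq0; apply: sympoly_ideal_gen.
set gs' := map _ gs.
have gs_eq0 g : g \in gs -> aq_pi gs' (sympoly_val g) = 0.
  by move=> g_gs; apply/eqP; rewrite aq_pi_eq0; apply/mem_ideal_gen/map_f.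
rewrite -aq_pi_eq0; apply/eqP.
apply: (kernel_interpolation w_prim r_neq0 (ltnW k_lt)) => //.
  move=> j j_n; rewrite -complete_mpolyE; apply: (gs_eq0 (complete k K j)).
  by rewrite mem_rcons inE map_f ?orbT // mem_index_iota.
apply/eqP; rewrite -subr_eq0 -rmorphB; apply/eqP.
have := gs_eq0 (complete k K n - ((-1) ^+ k.-1 * q)%:A).
rewrite mem_rcons inE eqxx => /(_ isT) <-.
congr (aq_pi _ _); rewrite (rmorphB (@sympoly_val k K)) /= complete_mpolyE.
congr (_ - _); transitivity (((-1) ^+ k.-1 * q) *: (1 : {mpoly K[k]})); last by [].
by rewrite -mul_mpolyC mulr1 rn.
Qed.

Let T : finType := {I : {set 'I_n} | #|I| == k}.
Let uT (I : T) (i : 'I_k) : 'I_n := enum_val (cast_ord (esym (eqP (valP I))) i).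

Let uT_inj I : injective (uT I).
Proof. by move=> i j /enum_val_inj /cast_ord_inj. Qed.

Let uT_mem I i : uT I i \in val I. Proof. exact: enum_valP. Qed.

Let uT_surj (I : T) l : l \in val I -> exists i, uT I i = l.
Proof.
move=> lI; exists (cast_ord (eqP (valP I)) (enum_rank_in lI l)).
by rewrite /uT cast_ordK enum_rankK_in.
Qed.

(** Up to a permutation, which a symmetric polynomial does not see, [u] is the chosen enumeration of
    its image, a k-subset. *)
Lemma meval_inj_points (f : S) :
  (forall I : T, (sympoly_val f).@[pt (uT I)] = 0) ->
  forall u, injective u -> (sympoly_val f).@[pt u] = 0.
Proof.
move=> f0 u u_inj.
have cu : #|[set u i | i : 'I_k]| == k by rewrite card_imset ?card_ord.
pose I : T := Sub [set u i | i : 'I_k] cu.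
have /fin_all_exists[t Dt] : forall i, exists j, uT I j = u i.
  by move=> i; apply: uT_surj; exact: imset_f.
have t_inj : injective t by move=> i j tij; apply: u_inj; rewrite -!Dt tij.
transitivity ((sympoly_val f).@[pt (uT I) \o perm t_inj]).
  by apply: meval_eq => i; rewrite /= /pt permE Dt.
by rewrite -meval_msym (issymP _ (sympolyP f)).
Qed.

Let sep (l : 'I_n) : S := SymPoly (prod_sub_sym k (r * w ^+ l : K)).
(* sep l vanishes at the points J containing l, so e0 I vanishes except at I. *)
Let e0 (I : T) : S := \prod_(l | l \notin val I) sep l.

Let e0E I v : (sympoly_val (e0 I)).@[v] =
  \prod_(l | l \notin val I) \prod_i (v i - r * w ^+ l).
Proof.
rewrite /e0 (rmorph_prod (@sympoly_val k K)) /= rmorph_prod /=; apply: eq_bigr => l _.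
by rewrite rmorph_prod /=; apply: eq_bigr => i _; rewrite mevalB mevalXU mevalC.
Qed.

Let e0_neq0 I : (sympoly_val (e0 I)).@[pt (uT I)] != 0.
Proof.
rewrite e0E; apply/prodf_neq0 => l lI; apply/prodf_neq0 => i _.
rewrite subr_eq0 /pt (inj_eq (mulfI r_neq0)) (eq_prim_root_expr w_prim) !modn_small //.
by apply: contra lI => /eqP /val_inj <-.
Qed.

Let e0_eq0 I J : I != J -> (sympoly_val (e0 I)).@[pt (uT J)] = 0.
Proof.
move=> IJ; have [l lJ lI] : exists2 l, l \in val J & l \notin val I.
  apply/subsetPn; apply: contra IJ => sJI; rewrite -(inj_eq val_inj) eq_sym eqEcard sJI.
  by rewrite (eqP (valP I)) (eqP (valP J)) /=.
have [i Di] := uT_surj lJ.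
by rewrite e0E (bigD1 l) //= (bigD1 i) //= /pt Di subrr !mul0r.
Qed.

Let e (I : T) : S := ((sympoly_val (e0 I)).@[pt (uT I)])^-1 *: e0 I.

Let eE I J : (sympoly_val (e I)).@[pt (uT J)] = (I == J)%:R.
Proof.
rewrite /e evZ; have [->|IJ] := eqVneq I J; first by rewrite mulVf ?e0_neq0.
by rewrite (e0_eq0 IJ) mulr0.
Qed.

Let b (I : T) : QH k n q := aq_pi gs (e I).
Let lam (I : T) : K := n%:R * \sum_i pt (uT I) i.

Let comb_meval (a : T -> K) J : (sympoly_val (\sum_I a I *: e I)).@[pt (uT J)] = a J.
Proof.
transitivity (\sum_I (sympoly_val (a I *: e I)).@[pt (uT J)]).
  by rewrite (raddf_sum (@sympoly_val k K)) raddf_sum.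
rewrite (bigD1 J) // big1 ?addr0 => [|I IJ].
  by rewrite evZ eE eqxx mulr1 /= addr0.
by rewrite evZ eE (negPf IJ) mulr0.
Qed.

Let comb_pi (a : T -> K) : \sum_I a I *: b I = aq_pi gs (\sum_I a I *: e I).
Proof. by rewrite raddf_sum; apply: eq_bigr => I _; rewrite -aq_piZ. Qed.

(** The coordinates are the values at the points: the difference then vanishes at every point, hence
    in the quotient. *)
Let b_span (v : QH k n q) : exists a : T -> K, v = \sum_I a I *: b I.
Proof.
pose f : S := repr v; exists (fun I => (sympoly_val f).@[pt (uT I)]).
rewrite comb_pi; apply/eqP; rewrite -subr_eq0 -[v]reprK -/(aq_pi gs f) -rmorphB.
apply/eqP/aq_pi_vanish/meval_inj_points => I.
by rewrite (raddfB (@sympoly_val k K)) mevalB comb_meval subrr.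
Qed.

Let b_free (a : T -> K) : \sum_I a I *: b I = 0 -> forall I, a I = 0.
Proof.
rewrite comb_pi => /eqP; rewrite aq_pi_eq0 => a0 I.
by rewrite -(comb_meval a I) (ideal_gen_meval _ a0).
Qed.

(** At the point of I the representative of c_1 takes the value [lam I], and at the other points
    [e I] is zero; so (c_1 - lam I) e_I vanishes at every point. *)
Let b_eigen I : @c1_mul R k n q (b I) = lam I *: b I.
Proof.
rewrite /c1_mul /c1 /b -/(aq_pi gs _) -rmorphM -aq_piZ.
apply/eqP; rewrite -subr_eq0 -rmorphB; apply/eqP/aq_pi_vanish/meval_inj_points => J.
rewrite (raddfB (@sympoly_val k K)) mevalB evM eE (evZ (lam I)) eE.
rewrite (raddfMn (@sympoly_val k K)) mevalMn [(sum_vars _ _).@[_]]raddf_sum /=.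
have [->|_] := eqVneq I J; last by rewrite !mulr0 subrr.
rewrite !mulr1; apply/eqP; rewrite subr_eq0 /lam mulr_natl; apply/eqP.
by congr (_ *+ _); apply: eq_bigr => i _; rewrite mevalXU.
Qed.

Let lamE I : lam I = n%:R * r * \sum_(l in val I) w ^+ l.
Proof.
rewrite /lam -mulr_sumr mulrA; congr (_ * _).
rewrite [RHS]big_enum_val [RHS](reindex (cast_ord (esym (eqP (valP I))))) //=.
by exists (cast_ord (eqP (valP I))) => i _; rewrite ?cast_ordK ?cast_ordKV.
Qed.

Lemma eigenvalues_equal_subset_sums :
  (exists s : seq R[i], eigenvalues_of (@c1_mul R k n q) s /\ ~~ uniq s) <->
  equal_subset_sums n k w.
Proof.
rewrite (nonuniq_eigenvaluesP b_span b_free b_eigen).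
have nr_neq0 : n%:R * r != 0
  by rewrite mulf_neq0 // pnatr_eq0 -lt0n (prim_order_gt0 w_prim).
split=> [[I [J [IJ]]]|[I [J [cI cJ IJ sumIJ]]]].
  rewrite !lamE => /(mulfI nr_neq0) sumIJ.
  by exists (val I), (val J); split;
    rewrite ?(eqP (valP I)) ?(eqP (valP J)) // (inj_eq val_inj).
exists (Sub I (introT eqP cI)), (Sub J (introT eqP cJ)); split.
  by rewrite -(inj_eq val_inj).
by rewrite !lamE !SubK sumIJ.
Qed.

End Points.

(** * Primitive roots, the quantum parameter and the conclusion *)

Lemma prim_root_exists (F : closedFieldType) n :
  n%:R != 0 :> F -> exists w : F, n.-primitive_root w.
Proof.
move=> n_neq0; have n_gt0 : (0 < n)%N by case: n n_neq0; rewrite // eqxx.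
have [s Ds] := closed_field_poly_normal ('X^n - 1 : {poly F}).
rewrite (monicP (monicXnsubC 1 n_gt0)) scale1r in Ds.
(* As n is nonzero in [F], X^n - 1 is separable and has n distinct roots; these form a cyclic
   group. *)
have s_uniq : uniq s.
  by rewrite -separable_prod_XsubC -Ds separable_Xn_sub_1.
have size_s : size s = n.
  by have := size_prod_XsubC s id; rewrite -Ds size_XnsubC // => -[].
have s1 : all n.-unity_root s.
  by apply/allP => x; rewrite -root_prod_XsubC -Ds.
by have /hasP[w _ ?] := cyclic.has_prim_root n_gt0 s1 s_uniq (eq_leq (esym size_s));
  exists w.
Qed.

Lemma cexp_neq0 (R : realType) (t : R[i]) : cexp t != 0.
Proof.
case: t => a b; rewrite /cexp eq_complex /= !mulf_eq0 (gt_eqF (expR_gt0 a)) /=.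
apply/negP => /andP[/eqP c0 /eqP s0].
by have := cos2Dsin2 b; rewrite c0 s0 expr0n addr0 => /esym /eqP; rewrite oner_eq0.
Qed.

(** The right-hand side does not involve [t], which is why one point of H^2 decides for all. *)
Lemma coalescing_atP (R : realType) k n (w t : R[i]) :
  (0 < k < n)%N -> n.-primitive_root w ->
  coalescing_at R k n t <-> equal_subset_sums n k w.
Proof.
move=> /andP[k_gt0 k_lt] w_prim.
have n_gt0 := prim_order_gt0 w_prim.
set q := cexp t.
have c_neq0 : (-1) ^+ k.-1 * q != 0 by rewrite mulf_neq0 ?cexp_neq0 // signr_eq0.
(* Any n-th root serves: the r w^l are then the roots of z^n = (-1)^(k-1) q. *)
pose r := n.-root ((-1) ^+ k.-1 * q).
apply: (@eigenvalues_equal_subset_sums R k n q r w) => //.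
  by rewrite rootC_eq0.
by rewrite rootCK.
Qed.

Close Scope ring_scope.

Theorem theorem4p4 (R : realType) :
  (forall k n : nat, 0 < k < n ->
    (forall t : complex R, coalescing_at R k n t <-> coalescing R k n) /\
    (coalescing R k n <-> pdiv n <= k <= n - pdiv n)) /\
  (forall p k : nat, prime p -> 0 < k < p -> ~ coalescing R k p).
Proof.
have bounds k n : (0 < k < n)%N ->
    (forall t : complex R, coalescing_at R k n t <-> coalescing R k n) /\
    (coalescing R k n <-> pdiv n <= k <= n - pdiv n)%N.
  move=> kn; have /andP[k_gt0 k_lt] := kn.
  have [|w w_prim] := @prim_root_exists R[i] n; first by rewrite pnatr_eq0; lia.
  have at_iff t : coalescing_at R k n t <-> equal_subset_sums n k w by exact:
    coalescing_atP.
  have some_iff : coalescing R k n <-> equal_subset_sums n k w.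
    by split=> [[t /at_iff]|] // eq_sums; exists (0 : R[i])%R; apply/at_iff.
  split=> [t|]; first by rewrite at_iff some_iff.
  rewrite some_iff; split; first exact: equal_subset_sums_pdiv_bounds.
  exact: pdiv_bounds_equal_subset_sums.
split=> // p k p_pr kp /(bounds k p kp).2.
(* For n = p prime the bounds read p <= k <= 0. *)
by rewrite pdiv_id // subnn; lia.
Qed.
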